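(* For a $\kappa$-Fréchet--Urysohn locally convex space $E$ with completion $\overline{E}$, the following assertions are equivalent: (i) $E$ is Baire-like; (ii) $E$ is barrelled; (iii) for every increasing sequence $\{A_n\}_{n\in\omega}$ of closed absolutely convex subsets of $E$ covering $E$, it follows that $\overline{E}=\bigcup_{n\in\omega}\overline{A_n}$, where $\overline{A_n}$ denotes the closure of $A_n$ in $\overline{E}$.
   Context: A Tychonoff space $X$ is $\kappa$-Fréchet--Urysohn if for any open set $U\subseteq X$ and each $x\in\overline{U}$ there exists a sequence in $U$ converging to $x$. A locally convex space $E$ is Baire-like if for any increasing sequence $\{A_n\}_{n\in\omega}$ of closed absolutely convex subsets of $E$ covering $E$, there is an $n\in\omega$ such that $A_n$ is a neighborhood of zero. $E$ is barrelled if every closed absolutely convex absorbing subset of $E$ is a neighborhood of zero. *)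

(* Defs.v *)
From HB Require Import structures.
From mathcomp Require Import all_boot all_order all_algebra.
From mathcomp Require Import all_classical all_reals all_analysis.
From mathcomp Require Import complex.

Set Implicit Arguments.
Unset Strict Implicit.
Unset Printing Implicit Defensive.

Import Order.TTheory GRing.Theory Num.Theory.
Import numFieldTopology.Exports.

Local Open Scope classical_set_scope.
Local Open Scope ring_scope.

Inductive scalar_kind := RealScalars | ComplexScalars.

Definition scalar_field (R : realType) (k : scalar_kind) : numFieldType :=
  match k with
  | RealScalars => R
  | ComplexScalars => R[i]
  end.

(* Meant for Tychonoff X; a Hausdorff uniform space is Tychonoff, cf.
   [uniform_completely_regular]. *)
Definition kappa_frechet_urysohn (X : topologicalType) : Prop :=
  forall (U : set X) (x : X), open U -> closure U x ->
    exists2 u : nat -> X, (forall n, U (u n)) & u @ \oo --> x.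

Section LocallyConvexSpaces.
Context {K : numFieldType}.

(* Local convexity is part of [tvsType]; the Hausdorff property is not, and is
   assumed separately. *)
Implicit Types E F : tvsType K.

Definition balanced E (A : set E) : Prop :=
  forall (a : K) (x : E), `|a| <= 1 -> A x -> A (a *: x).

Definition absolutely_convex E (A : set E) : Prop :=
  convex_set A /\ balanced A.

Definition absorbing E (A : set E) : Prop :=
  forall x : E, exists2 r : K, 0 < r & forall a : K, `|a| <= r -> A (a *: x).

Definition closed_absconvex_cover E (A : nat -> set E) : Prop :=
  [/\ forall m n, (m <= n)%N -> A m `<=` A n,
      forall n, closed (A n),
      forall n, absolutely_convex (A n) &
      \bigcup_n A n = [set: E]].

Definition baire_like E : Prop :=
  forall A : nat -> set E, closed_absconvex_cover A ->
    exists n, nbhs (0 : E) (A n).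

Definition barrelled E : Prop :=
  forall A : set E, closed A -> absolutely_convex A -> absorbing A ->
    nbhs (0 : E) A.

(* The uniform structure carried by a [tvsType] is only required to induce its
   topology, so it may differ from the translation-invariant one. Cauchy
   filters (hence completeness) are therefore defined from the neighborhoods
   of 0, not with the library's [cauchy]. *)
Definition tvs_cauchy E (G : set_system E) : Prop :=
  forall V : set E, nbhs (0 : E) V ->
    exists2 A : set E, G A & forall x y, A x -> A y -> V (x - y).

Definition tvs_complete E : Prop :=
  forall G : set_system E, ProperFilter G -> tvs_cauchy G ->
    exists l : E, G --> l.

Definition linear_embedding E F (j : {linear E -> F}) : Prop :=
  injective j /\
  forall U : set E, open U <-> exists2 V : set F, open V & j @^-1` V = U.

(* [F], with [j] as the inclusion of [E], is a completion of [E]. *)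
Record is_completion E F (j : {linear E -> F}) : Prop := {
  completion_hausdorff : hausdorff_space F ;
  completion_complete : tvs_complete F ;
  completion_embedding : linear_embedding j ;
  completion_dense : dense (range j)
}.

Definition closures_cover E F (j : {linear E -> F}) : Prop :=
  forall A : nat -> set E, closed_absconvex_cover A ->
    [set: F] = \bigcup_n closure (j @` A n).

End LocallyConvexSpaces.

Arguments baire_like {K} E.
Arguments barrelled {K} E.
Arguments tvs_complete {K} E.

(* Main.v *)
Require Import Defs.
From HB Require Import structures.
From mathcomp Require Import all_boot all_order all_algebra.
From mathcomp Require Import all_classical all_reals all_analysis.
From mathcomp Require Import complex unstable.

(** (i) => (ii). The multiples of a barrel by 1, 2, 3, ... form an increasing
    closed absolutely convex cover; one multiple is a neighborhood of 0, hence
    so is the barrel ([baire_like_barrelled]).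

    (ii) => (iii). Suppose that x in the completion lies in no closure of an
    A_n. Each n then has an absolutely convex neighborhood W_n of 0 such that x
    is not in A_n + W_n. The intersection B over n of the closed sets
    cl(A_n + W_n) is a barrel of E: a point of A_N belongs to all the terms
    from N on, and the first N terms are neighborhoods of 0. So B is a
    neighborhood of 0, and by density 4x = y + v with y in E, hence in some
    A_n, and v in the closure of B in the completion. Dividing by 4 the
    resulting decomposition of 4x, one finds x in A_n + W_n, a contradiction
    ([barrelled_closures_cover]).

    (iii) => (i). If no A_n is a neighborhood of 0, then 0 is in the closure of
    every open set U_n = E \ (n+1)A_n, and these sets decrease. The hypothesis
    on E, applied once to a union of translates of the U_n cut down near points
    that tend to 0, yields a single null sequence x_n with x_n in U_n
    ([kappa_frechet_urysohn_diagonal]). The closed absolutely convex hull B of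
    this sequence in the completion is a bounded complete disk, and by (iii)
    the closures of the A_n cover it. A Baire argument in the norm whose unit
    ball is B gives n and r > 0 such that rB is inside the closure of A_n
    ([complete_disk_absorbed]). So r x_m is in A_n for all m, which contradicts
    the choice of x_m as soon as m >= n and 1/(m+1) <= r
    ([closures_cover_baire_like]).

    The real and the complex case are treated at once, over an archimedean
    numeric field: the sequences 1/(n+1) supply all the small scalars. *)

Set Implicit Arguments.
Unset Strict Implicit.
Unset Printing Implicit Defensive.

Import Order.TTheory GRing.Theory Num.Theory.
Import numFieldTopology.Exports.

Local Open Scope classical_set_scope.
Local Open Scope ring_scope.

(** * Scalars *)

Lemma half_add_half (K : numFieldType) : 2^-1 + 2^-1 = 1 :> K.
Proof. by rewrite -mulr2n -(mulr_natr 2^-1) mulVf. Qed.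

Lemma exists_pos_le2 (K : numFieldType) (a b : K) :
  0 < a -> 0 < b -> exists2 c : K, 0 < c & c <= a /\ c <= b.
Proof.
move=> a0 b0; have [ab|/ltW ba] := real_leP (gtr0_real a0) (gtr0_real b0).
  by exists a.
by exists b.
Qed.

Definition archimedean (K : numFieldType) : Prop :=
  forall x : K, exists n : nat, `|x| < n%:R.

Lemma archimedean_invS (K : numFieldType) (r : K) : archimedean K -> 0 < r ->
  exists N, forall n, (N <= n)%N -> n.+1%:R^-1 <= r.
Proof.
move=> arch r0; have [N] := arch r^-1; rewrite gtr0_norm ?invr_gt0// => rN.
exists N => n Nn; rewrite -[r]invrK lef_pV2 ?posrE ?invr_gt0 ?ltr0Sn//.
by rewrite (le_trans (ltW rN))// ler_nat leqW.
Qed.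

Lemma scalar_field_archimedean (R : realType) (k : scalar_kind) :
  archimedean (scalar_field R k).
Proof.
have archR (x : R) : exists n : nat, `|x| < n%:R.
  by exists (Num.bound `|x|); rewrite archi_boundP.
case: k => [x|x] /=; first exact: archR.
have [n xn] := archR (complex.Re `|x|); exists n.
have nx : `|x| = (complex.Re `|x|)%:C%C.
  by rewrite normc_def.
rewrite nx -(rmorph_nat (real_complex R)) ltcR; apply: le_lt_trans xn.
exact: ler_norm.
Qed.

(** * Neighborhoods in a topological vector space *)

Section LinearContinuity.
Context {K : numFieldType} {E : tvsType K}.
Implicit Types (x y z : E) (a b r : K) (U V : set E).

Lemma lincomb_continuous a b :
  continuous (fun p : E * E => a *: p.1 + b *: p.2).
Proof.
move=> p; apply: (@continuous_comp _ _ _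
  (fun p : E * E => (a *: p.1, b *: p.2)) (fun q : E * E => q.1 + q.2)).
  apply: cvg_pair.
    apply: (@continuous_comp _ _ _ (fun p : E * E => (a : K^o, p.1))
      (fun z : K^o * E => z.1 *: z.2)); last exact: scale_continuous.
    apply: (@cvg_pair _ _ _ _ (nbhs (a : K^o))); last exact: cvg_fst.
    exact: cvg_cst.
  apply: (@continuous_comp _ _ _ (fun p : E * E => (b : K^o, p.2))
    (fun z : K^o * E => z.1 *: z.2)); last exact: scale_continuous.
  apply: (@cvg_pair _ _ _ _ (nbhs (b : K^o))); last exact: cvg_snd.
  exact: cvg_cst.
exact: add_continuous.
Qed.

Lemma affine_continuous a z : continuous (fun x : E => a *: x + z).
Proof.
have -> : (fun x : E => a *: x + z) =
    (fun p : E * E => a *: p.1 + 1 *: p.2) \o (fun x : E => (x, z)).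
  by apply/funext => x /=; rewrite scale1r.
move=> x; apply: continuous_comp; last exact: lincomb_continuous.
by apply: cvg_pair; [exact: cvg_id|exact: cvg_cst].
Qed.

Lemma nbhs_affine a z x U :
  nbhs (a *: x + z) U -> nbhs x [set y | U (a *: y + z)].
Proof. exact: affine_continuous. Qed.

Lemma nbhs_shift x U : nbhs x U -> nbhs 0 [set y | U (y + x)].
Proof.
move=> Ux; have := @nbhs_affine 1 x 0 U; rewrite scaler0 add0r => /(_ Ux).
by apply: filterS => y /=; rewrite scale1r.
Qed.

Lemma nbhs0_scale a U : nbhs 0 U -> nbhs 0 [set y | U (a *: y)].
Proof.
move=> U0; have := @nbhs_affine a 0 0 U; rewrite scaler0 addr0 => /(_ U0).
by apply: filterS => y /=; rewrite addr0.
Qed.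

Lemma nbhs_translate x U : nbhs 0 U -> nbhs x [set y | U (y - x)].
Proof.
move=> U0; have := @nbhs_affine 1 (- x) x U; rewrite scale1r subrr => /(_ U0).
by apply: filterS => y /=; rewrite scale1r.
Qed.

(** Joint continuity of scaling, with an explicit radius on the scalar side. *)
Lemma nbhs_scale a x U : nbhs (a *: x) U ->
  exists2 r, 0 < r & exists2 V, nbhs x V &
    forall b y, `|a - b| < r -> V y -> U (b *: y).
Proof.
move=> /(@scale_continuous K E (a, x) U) [[A V]] /= [aA xV] AVU.
move: aA => /nbhs_ballP [r /= r0 rA]; exists r => //; exists V => // b y abr Vy.
by apply: (AVU (b, y)); split => //=; apply: rA; rewrite -ball_normE.
Qed.

Lemma absorbing_nbhs0 (A : set E) : nbhs 0 A -> absorbing A.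
Proof.
move=> A0 x; have := @nbhs_scale 0 x A; rewrite scale0r.
move=> /(_ A0) [r r0 [V Vx VA]].
exists (r / 2); first by rewrite divr_gt0.
move=> a ar; apply: VA; last exact: nbhs_singleton.
rewrite sub0r normrN (le_lt_trans ar)// ltr_pdivrMr// mulr_natr mulr2n.
by rewrite ltrDl.
Qed.

(** The same scalars serve finitely many pairs of a neighborhood and a point;
    letting both vary covers a fixed point with many neighborhoods and a fixed
    neighborhood with many points. *)
Lemma absorbing_finitely (W : nat -> set E) (x : nat -> E) N :
    (forall n, nbhs 0 (W n)) ->
  exists2 r : K, 0 < r & forall a n, `|a| <= r -> (n < N)%N -> W n (a *: x n).
Proof.
move=> W0; elim: N => [|N [r r0 rW]]; first by exists 1.
have [s s0 sW] := absorbing_nbhs0 (W0 N) (x N).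
have [t t0 [tr ts]] := exists_pos_le2 r0 s0.
exists t => // a n at_; rewrite ltnS leq_eqVlt => /orP[/eqP ->|nN].
  by apply: sW; exact: le_trans ts.
by apply: rW => //; exact: le_trans tr.
Qed.

End LinearContinuity.

(** * Absolutely convex sets and neighborhoods of 0 *)

Section AbsolutelyConvex.
Context {K : numFieldType} {E : tvsType K}.
Implicit Types (x y z : E) (a b r : K) (U V A B W : set E).

(** A form without [{i01 K}] and without side cases, which makes stability
    under closure, images, preimages and intersections immediate. *)
Lemma absolutely_convexP A : absolutely_convex A <->
  forall a b x y, `|a| + `|b| <= 1 -> A x -> A y -> A (a *: x + b *: y).
Proof.
split=> [[cA bA] a b x y ab Ax Ay|AA].
  have [->|a0] := eqVneq a 0.
    rewrite scale0r add0r; apply: bA => //; apply: le_trans ab.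
    by rewrite lerDr.
  have [->|b0] := eqVneq b 0.
    rewrite scale0r addr0; apply: bA => //; apply: le_trans ab.
    by rewrite lerDl.
  have an0 : `|a| != 0 by rewrite normr_eq0.
  have bn0 : `|b| != 0 by rewrite normr_eq0.
  (* a x + b y is the convex combination, with weights |a|/s and |b|/s, of two
     multiples of x and y by scalars of norm s <= 1. *)
  pose s := `|a| + `|b|.
  have s0 : 0 < s by rewrite ltr_wpDr// normr_gt0.
  have sn0 : s != 0 by rewrite gt_eqF.
  have t0 : 0 <= `|a| / s by rewrite divr_ge0// ltW.
  have t1 : `|a| / s <= 1 by rewrite ler_pdivrMr// mul1r lerDl.
  have unit c : c != 0 -> `|s * (c / `|c|)| <= 1.
    move=> c0; rewrite normrM normf_div normr_id divff ?normr_eq0// mulr1.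
    by rewrite gtr0_norm.
  have := cA _ _ (Itv01 t0 t1) (mem_set (bA _ _ (unit a a0) Ax))
    (mem_set (bA _ _ (unit b b0) Ay)).
  rewrite inE; congr A; rewrite /conv /= /onem !scalerA; congr (_ *: _ + _ *: _).
    by rewrite mulrA divfK// mulrCA divff// mulr1.
  have -> : 1 - `|a| / s = `|b| / s.
    by rewrite -[1](divff sn0) -mulrBl /s addrC addKr.
  by rewrite mulrA divfK// mulrCA divff// mulr1.
split=> [x y t /[!inE] Ax Ay|a x a1 Ax].
  apply: AA => //; rewrite !ger0_norm ?onem_ge0//.
  by rewrite /onem addrC subrK.
by have := AA a 0 x x; rewrite scale0r addr0 normr0 addr0; exact.
Qed.

Lemma absconvex_scale A a x :
  absolutely_convex A -> `|a| <= 1 -> A x -> A (a *: x).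
Proof. by move=> [_ +]; exact. Qed.

Lemma absconvex0 A x : absolutely_convex A -> A x -> A 0.
Proof.
by move=> cA Ax; rewrite -(scale0r x); apply: absconvex_scale; rewrite ?normr0.
Qed.

Lemma absconvex_sum A a b x y : absolutely_convex A -> `|a| + `|b| <= 1 ->
  A x -> A y -> A (a *: x + b *: y).
Proof. by move=> /absolutely_convexP; exact. Qed.

Lemma absconvex_closure A :
  absolutely_convex A -> absolutely_convex (closure A).
Proof.
move=> /absolutely_convexP cA; apply/absolutely_convexP => a b x y ab Ax Ay U.
move=> /(@lincomb_continuous K E a b (x, y)) [[P Q] /= [Px Qy] PQU].
have [x' [Ax' Px']] := Ax _ Px; have [y' [Ay' Qy']] := Ay _ Qy.
exists (a *: x' + b *: y'); split; first exact: cA.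
exact: (PQU (x', y')).
Qed.

Lemma closure_subD A W x : nbhs 0 W -> absolutely_convex W -> closure A x ->
  exists2 y, A y & W (x - y).
Proof.
move=> W0 cW Ax; have [y [Ay Wxy]] := Ax _ (nbhs_translate x W0).
exists y => //; rewrite -opprB -scaleN1r; apply: absconvex_scale => //.
by rewrite normrN1.
Qed.

(** Inside a convex neighborhood V, the points all of whose multiples by scalars
    of norm at most 1 stay in V form a balanced convex set; it is a
    neighborhood because scaling is jointly continuous at (0, 0). *)
Lemma exists_absconvex_nbhs U : nbhs 0 U ->
  exists W, [/\ nbhs 0 W, absolutely_convex W & W `<=` U].
Proof.
move=> U0; have [B Bc [Bo /(_ 0 U U0) [V [BV V0] VU]]] := @locally_convex K E.
have Vc := Bc V (mem_set BV).
exists [set x | forall a, `|a| <= 1 -> V (a *: x)]; split.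
- have := @nbhs_scale K E 0 0 V; rewrite scaler0.
  move=> /(_ (open_nbhs_nbhs (conj (Bo _ BV) V0))).
  move=> [r r0 [P P0 PV]].
  apply: filterS (nbhs0_scale (2 / r) P0) => x /= Px a a1.
  have -> : a *: x = (a * (r / 2)) *: ((2 / r) *: x).
    rewrite scalerA -mulrA -[r / 2]invf_div mulVf ?mulr1//.
    by rewrite mulf_neq0// ?invr_neq0 ?gt_eqF.
  apply: PV => //; rewrite sub0r normrN normrM [`|r / 2|]gtr0_norm ?divr_gt0//.
  apply: (@le_lt_trans _ _ (r / 2)); first by rewrite ler_piMl// ltW// divr_gt0.
  by rewrite ltr_pdivrMr// mulr_natr mulr2n ltrDl.
- split=> [x y t /[!inE] Vx Vy a a1|b x b1 Vx a a1].
    rewrite /conv/= scalerDr !scalerA ![a * _]mulrC -!scalerA.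
    by apply/set_mem/Vc; rewrite inE; [exact: Vx|exact: Vy].
  by rewrite scalerA; apply: Vx; rewrite normrM mulr_ile1.
- by move=> x /(_ 1); rewrite normr1 scale1r => /(_ (lexx _))/VU.
Qed.

Lemma exists_closed_absconvex_nbhs U : nbhs 0 U ->
  exists W, [/\ nbhs 0 W, closed W, absolutely_convex W & W `<=` U].
Proof.
move=> U0; have [W [W0 cW WU]] := exists_absconvex_nbhs (nbhs0_scale 2 U0).
exists (closure W); split.
- by apply: filterS W0; exact: subset_closure.
- exact: closed_closure.
- exact: absconvex_closure.
- move=> x /(closure_subD W0 cW) [y Wy Wxy].
  have -> : x = 2 *: (2^-1 *: y + 2^-1 *: (x - y)).
    by rewrite -scalerDr addrC subrK scalerA divff ?scale1r.
  apply: WU; apply: absconvex_sum => //.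
  by rewrite gtr0_norm ?invr_gt0// half_add_half.
Qed.

Lemma absconvex_preimage_scale A a : absolutely_convex A ->
  absolutely_convex [set x : E | A (a *: x)].
Proof.
move=> cA; apply/absolutely_convexP => b c x y bc Ax Ay /=.
by rewrite scalerDr !scalerA ![a * _]mulrC -!scalerA; exact: absconvex_sum.
Qed.

Lemma absconvex_invS_homo A (m n : nat) x : absolutely_convex A ->
  (m <= n)%N -> A (m.+1%:R^-1 *: x) -> A (n.+1%:R^-1 *: x).
Proof.
move=> cA mn Ax.
have -> : n.+1%:R^-1 *: x = (n.+1%:R^-1 * m.+1%:R) *: (m.+1%:R^-1 *: x).
  by rewrite scalerA mulfK ?pnatr_eq0.
apply: absconvex_scale => //; rewrite ger0_norm ?mulr_ge0 ?invr_ge0//.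
by rewrite ler_pdivrMl ?ltr0Sn// mulr1 ler_nat.
Qed.

End AbsolutelyConvex.

(** * A Baire argument for bounded complete disks *)

Section BoundedDisks.
Context {K : numFieldType} {E : tvsType K}.
Implicit Types (x y z : E) (a r : K) (U V A B C W : set E).

(** One multiple of B is required to lie in A; when A is balanced, the smaller
    multiples follow. *)
Definition absorbs A B : Prop :=
  exists2 r : K, 0 < r & forall b, B b -> A (r *: b).

Definition tvs_bounded B : Prop := forall U, nbhs 0 U -> absorbs U B.

(** The translate p.1 + p.2 B of a multiple of B (for a nonzero scalar p.2),
    written as a preimage so that it is visibly closed when B is. *)
Definition disk B (p : E * K) : set E := [set x | B (p.2^-1 *: (x - p.1))].

Lemma diskP B (p : E * K) x : p.2 != 0 ->
  disk B p x <-> exists2 b, B b & x = p.1 + p.2 *: b.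
Proof.
move=> p0; split=> [Bx|[b Bb ->]].
  exists (p.2^-1 *: (x - p.1)) => //.
  by rewrite scalerA divff// scale1r addrC subrK.
by rewrite /disk/= addrC addKr scalerA mulVf// scale1r.
Qed.

Lemma closed_affine_preimage A a z :
  closed A -> closed [set x | A (a *: (x + z))].
Proof.
move=> cA.
have -> : [set x | A (a *: (x + z))] = (fun x => a *: x + a *: z) @^-1` A.
  by apply/seteqP; split => x /=; rewrite scalerDr.
by apply: preimage_closed => // x _; exact: affine_continuous.
Qed.

Lemma closed_disk B p : closed B -> closed (disk B p).
Proof. exact: closed_affine_preimage. Qed.

(** If C contained a whole translate s + (r/2) B, it would contain (r/2) B, by
    symmetry and convexity. So some center y in s + (r/2) B lies outside the
    closed set C, and boundedness of B gives room for a smaller disk around y. *)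
Lemma exists_disk_avoiding B C (p : E * K) (e : K) :
    absolutely_convex B -> tvs_bounded B ->
    closed C -> absolutely_convex C -> ~ absorbs C B -> 0 < p.2 -> 0 < e ->
  exists q : E * K,
    [/\ 0 < q.2, q.2 <= e, disk B q `<=` disk B p & disk B q `<=` ~` C].
Proof.
case: p => s r cB bB clC cC nabs /= r0 e0.
have r20 : 0 < r / 2 by rewrite divr_gt0.
have half := half_add_half K.
have n2 : `|2^-1 : K| = 2^-1 by rewrite gtr0_norm ?invr_gt0.
have [b Bb nCb] : exists2 b, B b & ~ C (s + (r / 2) *: b).
  apply: contrapT => h; apply: nabs; exists (r / 2) => // b Bb.
  have CB c : B c -> C (s + (r / 2) *: c).
    by move=> Bc; apply: contrapT => nC; apply: h; exists c.
  have CbN : C (s + (r / 2) *: - b).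
    by apply: CB; rewrite -scaleN1r; apply: absconvex_scale; rewrite ?normrN1.
  have := absconvex_sum (a := 2^-1) (b := - 2^-1) cC _ (CB _ Bb) CbN.
  rewrite normrN n2 half => /(_ (lexx _)); congr C.
  rewrite scaleNr -scalerBr opprD addrACA subrr add0r scalerN opprK -scalerDl.
  by rewrite -mulrDr half mulr1 scalerA mulrC.
pose y := s + (r / 2) *: b.
have : nbhs y (~` C) by apply: open_nbhs_nbhs; split => //; rewrite openC.
move=> /nbhs_shift/exists_absconvex_nbhs[W [W0 cW WC]].
have [t t0 tW] := bB _ W0.
have [c1 c10 [c1t c1e]] := exists_pos_le2 t0 e0.
have [c c0 [cr cc1]] := exists_pos_le2 r20 c10.
have cn0 : c != 0 by rewrite gt_eqF.
exists (y, c); split => //=; first exact: le_trans c1e.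
- move=> _ /(diskP _ (p := (y, c)) _ cn0)[b' Bb' ->] /=; rewrite /disk/= /y.
  have -> : r^-1 *: (s + (r / 2) *: b + c *: b' - s) = 2^-1 *: b + (c / r) *: b'.
    rewrite -[s + _ + _]addrA [s + _]addrC addrK.
    by rewrite scalerDr !scalerA mulrA mulVf ?mul1r ?gt_eqF// [c / r]mulrC.
  apply: absconvex_sum => //; rewrite n2 gtr0_norm ?divr_gt0// -[leRHS]half lerD2l.
  by rewrite ler_pdivrMr// mulrC.
- move=> _ /(diskP _ (p := (y, c)) _ cn0)[b' Bb' ->] /= Cyb.
  have : W (c *: b').
    have -> : c *: b' = (c / t) *: (t *: b') by rewrite scalerA divfK ?gt_eqF.
    apply: absconvex_scale => //; last exact: tW.
    by rewrite gtr0_norm ?divr_gt0// ler_pdivrMr// mul1r (le_trans cc1).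
  by move=> /WC; apply; rewrite /= addrC.
Qed.

(** Baire category in the normed space spanned by B: if no C_n absorbs B, nested
    disks that avoid C_0, C_1, ... in turn and shrink to a point have a center
    sequence that is Cauchy because B is bounded; its limit is in no C_n. *)
Lemma complete_disk_absorbed B (C : nat -> set E) :
    archimedean K -> tvs_complete E ->
    closed B -> absolutely_convex B -> tvs_bounded B -> B 0 ->
    (forall n, closed (C n)) -> (forall n, absolutely_convex (C n)) ->
    \bigcup_n C n = [set: E] ->
  exists n, absorbs (C n) B.
Proof.
move=> arch complE clB cB bB B0 clC cC coverC; apply: contrapT => nabs.
(* The step is total in the pair np, so that choice gives a plain function to
   iterate; its guarantee only concerns positive radii. *)
have step (np : nat * (E * K)) : exists q : E * K, 0 < np.2.2 ->
    [/\ 0 < q.2, q.2 <= np.1.+1%:R^-1, disk B q `<=` disk B np.2 &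
        disk B q `<=` ~` C np.1].
  have [p0|p0] := pselect (0 < np.2.2); last by exists np.2.
  have nC : ~ absorbs (C np.1) B by move=> ab; apply: nabs; exists np.1.
  have e0 : 0 < np.1.+1%:R^-1 :> K by rewrite invr_gt0 ltr0Sn.
  have [q Hq] := exists_disk_avoiding cB bB (clC _) (cC _) nC p0 e0.
  by exists q.
have [f fP] := choice step.
pose q := fix q n := if n is m.+1 then f (m, q m) else (0 : E, 1 : K).
have q0 n : 0 < (q n).2 by elim: n => //= n /(fP (n, q n))[].
have qS n := fP (n, q n) (q0 n).
have qdec m n : (m <= n)%N -> disk B (q n) `<=` disk B (q m).
  elim: n => [|n IHn]; first by rewrite leqn0 => /eqP ->.
  rewrite leq_eqVlt => /orP[/eqP -> //|]; rewrite ltnS => /IHn.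
  by have [_ _ qn _] := qS n; exact: subset_trans.
have center n : disk B (q n) (q n).1 by rewrite /disk/= subrr scaler0.
pose s n := (q n).1.
have tail n : \forall m \near \oo, disk B (q n) (s m).
  by near=> m; apply: (qdec n m) => //; near: m; exact: nbhs_infty_ge.
have [l sl] : exists l : E, s @ \oo --> l.
  apply: complE => V /exists_absconvex_nbhs[W [W0 cW WV]].
  have [r r0 rB] := bB _ W0.
  have [N /(_ N (leqnn _)) Nr] := archimedean_invS arch (divr_gt0 r0 (ltr0n _ 2)).
  exists (disk B (q N.+1)); first exact: tail.
  have [c0 cN _ _] := qS N; have cn0 := lt0r_neq0 c0.
  move=> x y /(diskP _ _ cn0)[b Bb ->] /(diskP _ _ cn0)[b' Bb' ->].
  apply: WV; set c := (q N.+1).2.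
  have -> : (q N.+1).1 + c *: b - ((q N.+1).1 + c *: b') =
      (c / r) *: (r *: b) + (- (c / r)) *: (r *: b').
    rewrite !scalerA mulNr divfK ?gt_eqF// scaleNr opprD addrACA subrr add0r.
    by [].
  apply: absconvex_sum; [by []| |exact: rB|exact: rB].
  rewrite normrN gtr0_norm ?divr_gt0// -mulr2n -mulr_natr -ler_pdivlMr// mul1r.
  rewrite ler_pdivrMr// mulrC; exact: le_trans Nr.
have ldisk n : disk B (q n) l.
  apply: (@closed_cvg _ _ _ _ s (disk B (q n)) _ _ l sl); last exact: tail.
  exact: closed_disk.
have : [set: E] l by []; rewrite -coverC => -[n _ Cl].
by have [_ _ _ /(_ l (ldisk n.+1))] := qS n; exact.
Unshelve. all: by end_near. Qed.

End BoundedDisks.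

(** * Null sequences in kappa-Frechet-Urysohn spaces *)

Section NullSequences.
Context {K : numFieldType} {E : tvsType K}.
Implicit Types (x y z : E) (a r : K) (U : nat -> set E).

Lemma invS_scale_cvg0 (z : E) : archimedean K ->
  (fun n => n.+1%:R^-1 *: z) @ \oo --> (0 : E).
Proof.
move=> arch V /absorbing_nbhs0/(_ z) [r r0 rV].
have [N HN] := archimedean_invS arch r0.
exists N => // n /= Nn; apply: rV.
by rewrite gtr0_norm ?invr_gt0 ?ltr0Sn//; exact: HN.
Qed.

(** The hypothesis speaks of one open set, while a diagonal sequence is needed.
    Translate the trace of U_n near 0 to a point t_n = z/(n+1), inside a set Q_n
    that is separated from 0, and take a sequence w in the union W of these
    translates that converges to 0. It leaves each Q_n eventually, so the index
    k_i of the translate that contains w_i is unbounded, and the differences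
    w_i - t_(k_i) form a null sequence of the required kind. *)
Lemma kappa_frechet_urysohn_diagonal U :
    archimedean K -> hausdorff_space E -> kappa_frechet_urysohn E ->
    (forall n, open (U n)) -> (forall m n, (m <= n)%N -> U n `<=` U m) ->
    (forall n, closure (U n) 0) ->
  exists2 x : nat -> E, (forall n, U n (x n)) & x @ \oo --> (0 : E).
Proof.
move=> arch hausE kfu oU decU U0.
have [[z /eqP z0]|triv] := pselect (exists z : E, z <> 0); last first.
  exists (fun=> 0); last exact: cvg_cst.
  move=> n; have [y [Uy _]] := U0 n _ (@filterT _ _ (nbhs_filter _)).
  by have <- : y = 0 by apply: contrapT => ?; apply: triv; exists y.
pose t n := n.+1%:R^-1 *: z.
have t0 n : 0 != t n by rewrite eq_sym scaler_eq0 negb_or invr_eq0 pnatr_eq0.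
have sep n : exists PQ : set E * set E,
    [/\ nbhs 0 PQ.1, open PQ.2, PQ.2 (t n) & PQ.1 `&` PQ.2 = set0].
  move: hausE; rewrite open_hausdorff => /(_ 0 (t n) (t0 n)).
  move=> [[P Q] /= [/[!inE] P0 Qt] [oP oQ PQ]].
  exists (P, Q); split => //=.
  exact: (@open_nbhs_nbhs _ 0 P).
have [PQ PQP] := choice sep.
pose W := \bigcup_n ((PQ n).2 `&` [set w | U n (w - t n)]).
have oW : open W.
  apply: bigcup_open => n _; apply: openI; first by case: (PQP n).
  have -> : [set w | U n (w - t n)] = (fun w => 1 *: w + - t n) @^-1` U n.
    by apply/seteqP; split => w /=; rewrite scale1r.
  by apply: open_comp => // w _; exact: affine_continuous.
have W0 : closure W 0.
  move=> V /nbhs_interior V0.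
  have [n _ /(_ n (leqnn n)) Vt] := invS_scale_cvg0 z arch V0.
  have [_ oQ Qt _] := PQP n.
  have /nbhs_shift/(U0 n) [y [Uy [Vy Qy]]] : nbhs (t n) (V `&` (PQ n).2).
    by apply: filterI => //; apply: open_nbhs_nbhs.
  exists (y + t n); split => //; exists n => //; split => //=.
  by rewrite addrK.
have [w wW w0] := kfu W 0 oW W0.
have Wk i : exists k, (PQ k).2 (w i) /\ U k (w i - t k).
  by have [k _ []] := wW i; exists k.
have [k kP] := choice Wk.
(* w enters the neighborhoods of 0 that are disjoint from Q_0, ..., Q_(m-1). *)
have large m : exists i, (m <= i)%N /\ (m <= k i)%N.
  have : \forall i \near \oo, forall n : 'I_m, (PQ n).1 (w i).
    by apply: filter_forall => n; apply: w0; case: (PQP n).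
  move=> [N _ HN]; exists (maxn m N); rewrite leq_maxl; split => //.
  rewrite leqNgt; apply/negP => km.
  have Pw := HN (maxn m N) (leq_maxr _ _) (Ordinal km).
  have [_ _ _] := PQP (k (maxn m N)); rewrite -subset0; apply.
  by split; [exact: Pw|case: (kP (maxn m N))].
have [i iP] := choice large.
exists (fun m => w (i m) - t (k (i m))).
  by move=> m; apply: (decU m (k (i m))); [case: (iP m)|case: (kP (i m))].
move=> V V0; have := @lincomb_continuous K E 1 (-1) (0, 0) V.
rewrite /= !scaler0 addr0 => /(_ V0) [[A B] /= [A0 B0] ABV].
have [N1 _ HN1] := w0 _ A0; have [N2 _ HN2] := invS_scale_cvg0 z arch B0.
exists (maxn N1 N2) => // m /=; rewrite geq_max => /andP[m1 m2].
have [mi mk] := iP m.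
have := ABV (w (i m), t (k (i m))); rewrite /= scale1r scaleN1r; apply; split.
  by apply: HN1; exact: leq_trans mi.
by apply: HN2; exact: leq_trans mk.
Qed.

Definition closed_absconvex_hull (A : set E) : set E :=
  \bigcap_(D in [set D | [/\ closed D, absolutely_convex D & A `<=` D]]) D.

Lemma closed_absconvex_hull_closed A : closed (closed_absconvex_hull A).
Proof. by apply: closed_bigI => D []. Qed.

Lemma absolutely_convex_hull A : absolutely_convex (closed_absconvex_hull A).
Proof.
apply/absolutely_convexP => a b x y ab Ax Ay D DA.
by apply: absconvex_sum; [case: DA|exact: ab|exact: Ax|exact: Ay].
Qed.

Lemma sub_closed_absconvex_hull A : A `<=` closed_absconvex_hull A.
Proof. by move=> x Ax D [_ _]; exact. Qed.

Lemma closed_preimage_scale (A : set E) a : closed A ->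
  closed [set x : E | A (a *: x)].
Proof.
move=> /(@closed_affine_preimage K E A a 0); congr closed.
by apply/seteqP; split => x /=; rewrite addr0.
Qed.

Lemma bounded_closed_absconvex_hull A :
  tvs_bounded A -> tvs_bounded (closed_absconvex_hull A).
Proof.
move=> bA U /exists_closed_absconvex_nbhs[W [W0 clW cW WU]].
have [r r0 rW] := bA _ W0; exists r => // x Ax; apply: WU.
apply: (Ax [set x | W (r *: x)]); split=> //.
  exact: closed_preimage_scale.
exact: absconvex_preimage_scale.
Qed.

Lemma bounded_range_cvg0 (x : nat -> E) : x @ \oo --> (0 : E) ->
  tvs_bounded (range x).
Proof.
move=> x0 U /exists_absconvex_nbhs[W [W0 cW WU]].
have [N _ HN] := x0 _ W0.
have [r r0 rW] := absorbing_finitely x N (fun=> W0).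
have [s s0 [sr s1]] := exists_pos_le2 r0 (ltr01 : 0 < 1 :> K).
exists s => // _ [n _ <-]; apply: WU; have [nN|Nn] := ltnP n N.
  by apply: rW => //; rewrite gtr0_norm.
by apply: absconvex_scale => //; [rewrite gtr0_norm|exact: HN].
Qed.

End NullSequences.

(** * Embeddings and dense subspaces *)

Section Embeddings.
Context {K : numFieldType} {E F : tvsType K} (j : {linear E -> F}).
Implicit Types (A : set E).

Lemma linear_embedding_continuous : linear_embedding j -> continuous j.
Proof. by move=> [_ jo]; apply/continuousP => V oV; apply/jo; exists V. Qed.

Lemma closure_embedding A x : linear_embedding j -> closed A ->
  closure (j @` A) (j x) -> A x.
Proof.
move=> [_ jo] clA Ajx; apply: contrapT => nAx.
have [V oV VA] := (jo (~` A)).1 (closed_openC clA).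
have Vjx : V (j x) by change ((j @^-1` V) x); rewrite VA.
have [_ [[y Ay <-] Vjy]] := Ajx _ (open_nbhs_nbhs (conj oV Vjx)).
have : (j @^-1` V) y by [].
by rewrite VA; exact.
Qed.

Lemma absconvex_image A : absolutely_convex A -> absolutely_convex (j @` A).
Proof.
move=> cA; apply/absolutely_convexP => a b _ _ ab [x Ax <-] [y Ay <-].
by exists (a *: x + b *: y); [exact: absconvex_sum|rewrite linearP linearZ].
Qed.

End Embeddings.

Lemma dense_nbhs (T : topologicalType) (D A : set T) (x : T) :
  dense D -> nbhs x A -> A `&` D !=set0.
Proof.
move=> dD /nbhs_interior Ax; have [|y [Ay Dy]] := dD A° _ (open_interior A).
  by exists x; exact: nbhs_singleton.
by exists y; split => //; exact: interior_subset.
Qed.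

(** * The three implications *)

Lemma baire_like_barrelled (K : numFieldType) (E : tvsType K) :
  archimedean K -> baire_like E -> barrelled E.
Proof.
move=> arch bE A clA cA absA.
have [|n] := bE (fun n => [set x | A (n.+1%:R^-1 *: x)]); last first.
  move=> /(nbhs0_scale n.+1%:R); apply: filterS => x /=.
  by rewrite scalerA mulVf ?scale1r// pnatr_eq0.
split.
- by move=> m n mn x; exact: absconvex_invS_homo.
- by move=> n; exact: closed_preimage_scale.
- by move=> n; exact: absconvex_preimage_scale.
- apply/seteqP; split=> // x _; have [r r0 rA] := absA x.
  have [N HN] := archimedean_invS arch r0; exists N => //=.
  by apply: rA; rewrite gtr0_norm ?invr_gt0 ?ltr0Sn//; exact: HN.
Qed.

Lemma closures_cover_baire_like (K : numFieldType) (E F : tvsType K)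
    (j : {linear E -> F}) :
    archimedean K -> hausdorff_space E -> kappa_frechet_urysohn E ->
    tvs_complete F -> linear_embedding j ->
  closures_cover j -> baire_like E.
Proof.
move=> arch hausE kfuE complF embj coverj A Acover; apply: contrapT => nA.
have [incA clA cA covA] := Acover.
pose U n := ~` [set x | A n (n.+1%:R^-1 *: x)].
have [x Ux x0] :
    exists2 x : nat -> E, (forall n, U n (x n)) & x @ \oo --> (0 : E).
  apply: kappa_frechet_urysohn_diagonal => //.
  - by move=> n; rewrite openC; exact: closed_preimage_scale.
  - move=> m n mn y; apply: contra_not => /= /(incA _ _ mn) Ay.
    exact: absconvex_invS_homo (cA n) mn Ay.
  - move=> n V V0; apply: contrapT => UV; apply: nA; exists n.
    apply: filterS (nbhs0_scale n.+1%:R V0) => y /= Vy.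
    apply: contrapT => nAy; apply: UV; exists (n.+1%:R *: y); split => //=.
    by rewrite /U/= scalerA mulVf ?pnatr_eq0// scale1r.
have jcont := linear_embedding_continuous embj.
have jx0 : (j \o x) @ \oo --> (0 : F).
  rewrite -(linear0 j); apply: continuous_cvg => //; exact: jcont.
pose B := closed_absconvex_hull (range (j \o x)).
have jB n : B (j (x n)) by apply: sub_closed_absconvex_hull; exists n.
have [n [r r0 rB]] : exists n, absorbs (closure (j @` A n)) B.
  apply: complete_disk_absorbed => //.
  - exact: closed_absconvex_hull_closed.
  - exact: absolutely_convex_hull.
  - exact/bounded_closed_absconvex_hull/bounded_range_cvg0.
  - exact: absconvex0 (absolutely_convex_hull _) (jB 0%N).
  - by move=> n; exact: closed_closure.
  - by move=> n; exact/absconvex_closure/absconvex_image.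
  - by rewrite -coverj.
have [N HN] := archimedean_invS arch r0.
pose m := maxn n N.
have Ax : A n (r *: x m).
  by apply: (closure_embedding embj) => //; rewrite linearZ; exact: rB.
apply: (Ux m); apply: (incA n); first exact: leq_maxl.
have -> : m.+1%:R^-1 *: x m = (m.+1%:R^-1 / r) *: (r *: x m).
  by rewrite scalerA divfK ?gt_eqF.
apply: absconvex_scale => //.
rewrite gtr0_norm ?divr_gt0 ?invr_gt0 ?ltr0Sn// ler_pdivrMr// mul1r.
by apply: HN; exact: leq_maxr.
Qed.

Lemma barrelled_closures_cover (K : numFieldType) (E F : tvsType K)
    (j : {linear E -> F}) :
    linear_embedding j -> dense (range j) ->
  barrelled E -> closures_cover j.
Proof.
move=> embj densej barE A [incA clA cA covA].
have jcont := linear_embedding_continuous embj.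
apply/esym/seteqP; split=> // x _; apply: contrapT => nx.
have sep n : exists W : set F, [/\ nbhs 0 W, absolutely_convex W &
    forall a w, A n a -> W w -> x <> j a + w].
  have : nbhs x (~` closure (j @` A n)).
    apply: open_nbhs_nbhs; split; first by rewrite openC; exact: closed_closure.
    by move=> Ax; apply: nx; exists n.
  move=> /nbhs_shift/exists_absconvex_nbhs[W [W0 cW WA]].
  exists W; split=> // a w Aa Ww xaw; apply: (WA (- w)).
    by rewrite -scaleN1r; apply: absconvex_scale => //; rewrite normrN1.
  by rewrite xaw addrCA addNr addr0; apply: subset_closure; exists a.
have [W WP] := choice sep.
(* Some A_n may be empty, and then so is A_n + W_n: B only takes into account
   the indices n such that A_n contains 0. *)
pose S n := [set y : F | exists2 a, A n a & W n (y - j a)].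
pose B := [set y : E | forall n, A n 0 -> closure (S n) (j y)].
have cS n : absolutely_convex (S n).
  apply/absolutely_convexP => b c u v bc [a Aa Wa] [a' Aa' Wa'].
  exists (b *: a + c *: a'); first exact: absconvex_sum.
  rewrite linearP linearZ/= opprD addrACA -!scalerBr.
  by apply: absconvex_sum => //; case: (WP n).
have nbhsW n : nbhs 0 (W n) by case: (WP n).
have W0 n : W n 0 := nbhs_singleton (nbhsW n).
have barB : nbhs 0 B.
  apply: barE.
  - have -> : B = \bigcap_(n in [set n | A n 0]) (j @^-1` closure (S n)).
      by apply/seteqP; split.
    apply: closed_bigI => n _; apply: preimage_closed; last exact: closed_closure.
    by move=> y _; exact: jcont.
  - apply/absolutely_convexP => b c u v bc Bu Bv n An0; rewrite linearP linearZ/=.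
    by apply: absconvex_sum bc (Bu n An0) (Bv n An0); exact: absconvex_closure.
  - move=> y; have : [set: E] y by [].
    rewrite -covA => -[N _ ANy].
    have [r r0 rW] := absorbing_finitely (fun=> j y) N nbhsW.
    have [s s0 [sr s1]] := exists_pos_le2 r0 (ltr01 : 0 < 1 :> K).
    exists s => // a a_s n An0; apply: subset_closure; rewrite linearZ/=.
    have [nN|Nn] := ltnP n N.
      exists 0 => //; rewrite linear0 subr0; apply: rW => //.
      exact: le_trans sr.
    exists (a *: y); last by rewrite linearZ subrr.
    apply: absconvex_scale => //; first exact: le_trans s1.
    exact: incA ANy.
have [V [oV V0 VB]] : exists V : set F, [/\ open V, V 0 & j @^-1` V `<=` B].
  move: barB; rewrite nbhsE => -[T [oT T0] TB].
  have [V oV VT] := (embj.2 T).1 oT; exists V; split => //.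
    by rewrite -(linear0 j); change ((j @^-1` V) 0); rewrite VT.
  by rewrite VT.
(* 4 x will be a sum of two elements of A_n and three of W_n; dividing by 4
   brings the partial sums back into A_n and W_n. *)
have [y Vy] : exists y, V (4 *: x - j y).
  have : nbhs (4 *: x) [set v | V (4 *: x - v)].
    have := @nbhs_affine K F (-1) (4 *: x) (4 *: x) V.
    rewrite scaleN1r addNr => /(_ (open_nbhs_nbhs (conj oV V0))).
    by apply: filterS => v /=; rewrite scaleN1r addrC.
  by move=> /(dense_nbhs densej) [v [/= Vv [y _ yE]]]; exists y; rewrite yE.
have [n _ Any] : (\bigcup_n A n) y by rewrite covA.
have [Wn0 cWn WnP] := WP n.
have [v [[Vy' Wy'] [y' _ jy']]] := dense_nbhs densej (filterI
  (open_nbhs_nbhs (conj oV Vy)) (nbhs_translate _ Wn0)).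
rewrite -jy' /= in Vy' Wy'.
have [u [a Aa Wu] Wyu] :=
  closure_subD Wn0 cWn (VB y' Vy' n (absconvex0 (cA n) Any)).
have n2 : `|2^-1 : K| = 2^-1 by rewrite gtr0_norm ?invr_gt0.
have n4 : `|4^-1 : K| = 4^-1 by rewrite gtr0_norm ?invr_gt0.
have half := half_add_half K.
have quarter : 4^-1 = 2^-1 * 2^-1 :> K by rewrite -invfM -natrM.
have le42 : 4^-1 <= 2^-1 :> K by rewrite lef_pV2 ?posrE// ler_nat.
(* 4 x = y + a + w1 + w2 + w3 with y, a in A_n and w1, w2, w3 in W_n: a itself
   comes from approximating j y' by S_n, j y' from approximating 4 x - y. *)
pose w := 4^-1 *: (u - j a + (j y' - u) + (4 *: x - j y - j y')).
apply: (WnP (4^-1 *: y + 4^-1 *: a) w).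
- by apply: absconvex_sum => //; rewrite n4 -[leRHS]half lerD.
- have -> : w = 2^-1 *: (2^-1 *: (u - j a) + 2^-1 *: (j y' - u)) +
      (- 4^-1) *: (j y' - (4 *: x - j y)).
    by rewrite /w scaleNr -scalerN opprB -scalerDr scalerA -quarter -scalerDr.
  apply: absconvex_sum => //; first by rewrite normrN n2 n4 -[leRHS]half lerD.
  by apply: absconvex_sum => //; rewrite n2 half.
- rewrite linearP linearZ/= /w -!scalerDr.
  have -> : j y + j a + (u - j a + (j y' - u) + (4 *: x - j y - j y')) = 4 *: x.
    rewrite [u - j a + _]addrC subrKA [j y' - j a + _]addrC subrKA.
    by rewrite -[_ - j y - j a]addrA -opprD [LHS]addrC subrK.
  by rewrite scalerA mulVf ?scale1r.
Qed.

Theorem theorem5p2 (R : realType) (k : scalar_kind)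
    (E Ebar : tvsType (scalar_field R k)) (j : {linear E -> Ebar})
    (hausE : hausdorff_space E)
    (kfuE : kappa_frechet_urysohn E)
    (complE : is_completion j) :
  [<-> baire_like E; barrelled E; closures_cover j].
Proof.
have arch := @scalar_field_archimedean R k.
have [_ complF embj densej] := complE.
tfae.
- exact: baire_like_barrelled.
- exact: barrelled_closures_cover.
- exact: closures_cover_baire_like.
Qed.
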